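(* Let $C$ be a fuzzy conjunction, $D$ a fuzzy disjunction, and $\mathcal{A}=\{\mathbf{a}^1,\ldots,\mathbf{a}^k\}\subset[0,1]^n$. Let $\mathcal{V}$ and $\mathcal{S}$ be respectively the max-$C$ PAFMM and the min-$D$ PAFMM associated with $\mathcal{A}$. If $C$ has a left identity, then $\mathcal{V}(\mathbf{a}^\xi)=\mathbf{a}^\xi$ for all $\xi\in\{1,\ldots,k\}$. Dually, if $D$ has a left identity, then $\mathcal{S}(\mathbf{a}^\xi)=\mathbf{a}^\xi$ for all $\xi\in\{1,\ldots,k\}$.
   Context: A fuzzy conjunction is a mapping $C:[0,1]\times[0,1]\to[0,1]$ that is nondecreasing in both arguments with $C(0,0)=C(0,1)=C(1,0)=0$ and $C(1,1)=1$ (hence $C(0,x)=C(x,0)=0$ for all $x$). A fuzzy disjunction is a mapping $D:[0,1]\times[0,1]\to[0,1]$ that is nondecreasing in both arguments with $D(0,0)=0$ and $D(0,1)=D(1,0)=D(1,1)=1$. A left identity of $C$ is an $e\in[0,1]$ such that $C(e,x)=x$ for all $x\in[0,1]$; likewise, a left identity of $D$ is an $e\in[0,1]$ with $D(e,x)=x$ for all $x\in[0,1]$. Vectors in $[0,1]^n$ are ordered componentwise; $\bigvee$ and $\bigwedge$ denote the componentwise supremum and infimum in $[0,1]^n$. For $\lambda\in[0,1]$ and $\mathbf{a}\in[0,1]^n$, $C(\lambda,\mathbf{a})$ is the vector with components $C(\lambda,a_i)$; similarly for $D(\theta,\mathbf{a})$. The sets of all max-$C$ and min-$D$ combinations of $\mathcal{A}=\{\mathbf{a}^1,\ldots,\mathbf{a}^k\}$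 are $$\mathcal{C}(\mathcal{A})=\Big\{\bigvee_{\xi=1}^k C(\lambda_\xi,\mathbf{a}^\xi):\lambda_\xi\in[0,1]\Big\},\qquad \mathcal{D}(\mathcal{A})=\Big\{\bigwedge_{\xi=1}^k D(\theta_\xi,\mathbf{a}^\xi):\theta_\xi\in[0,1]\Big\}.$$ The max-$C$ projection autoassociative fuzzy morphological memory (max-$C$ PAFMM) $\mathcal{V}$ and the min-$D$ PAFMM $\mathcal{S}$ associated with $\mathcal{A}$ are the maps $[0,1]^n\to[0,1]^n$ defined by $$\mathcal{V}(\mathbf{x})=\bigvee\{\mathbf{z}\in\mathcal{C}(\mathcal{A}):\mathbf{z}\leq\mathbf{x}\},\qquad \mathcal{S}(\mathbf{x})=\bigwedge\{\mathbf{y}\in\mathcal{D}(\mathcal{A}):\mathbf{y}\geq\mathbf{x}\}.$$ *)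

(* Defs.v *)
From mathcomp Require Import all_boot all_order all_algebra.
From mathcomp Require Import all_classical all_reals interval_inference.

Set Implicit Arguments.
Unset Strict Implicit.
Unset Printing Implicit Defensive.

Import Order.TTheory GRing.Theory Num.Theory.
Local Open Scope classical_set_scope.
Local Open Scope ring_scope.

Section FuzzyOperations.
Variable R : realType.
Local Notation I := {i01 R}.

Record fuzzy_conjunction (C : I -> I -> I) : Prop := FuzzyConjunction {
  conj_monol : forall y, {homo C^~ y : x1 x2 / x1 <= x2} ;
  conj_monor : forall x, {homo C x : y1 y2 / y1 <= y2} ;
  conj00 : C 0%:i01 0%:i01 = 0%:i01 ;
  conj01 : C 0%:i01 1%:i01 = 0%:i01 ;
  conj10 : C 1%:i01 0%:i01 = 0%:i01 ;
  conj11 : C 1%:i01 1%:i01 = 1%:i01 }.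

Record fuzzy_disjunction (D : I -> I -> I) : Prop := FuzzyDisjunction {
  disj_monol : forall y, {homo D^~ y : x1 x2 / x1 <= x2} ;
  disj_monor : forall x, {homo D x : y1 y2 / y1 <= y2} ;
  disj00 : D 0%:i01 0%:i01 = 0%:i01 ;
  disj01 : D 0%:i01 1%:i01 = 1%:i01 ;
  disj10 : D 1%:i01 0%:i01 = 1%:i01 ;
  disj11 : D 1%:i01 1%:i01 = 1%:i01 }.

End FuzzyOperations.

Section CompleteLattice.
Variable R : realType.
Local Notation I := {i01 R}.
Implicit Type A : set I.

Lemma i01_ge0 (x : I) : 0%:i01 <= x.
Proof. by rewrite -num_le /=; apply: ge0. Qed.

Lemma i01_le1 (x : I) : x <= 1%:i01.
Proof. by rewrite -num_le /=; apply: le1. Qed.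

Lemma i01_supremums A : supremums A !=set0.
Proof.
have [->|/set0P[a Aa]] := eqVneq A set0.
  by exists 0%:i01; split=> [x []|y _]; exact: i01_ge0.
pose B := [set x%:num | x in A].
have B0 : B !=set0 by exists a%:num, a.
have B1 : ubound B 1 by move=> _ [x _ <-]; apply: le1.
have supB0 : 0 <= sup B.
  by apply: (@le_trans _ _ a%:num); [exact: ge0|apply: ub_le_sup; [exists 1|exists a]].
have supB1 : sup B <= 1 by exact: ge_sup.
exists (Itv01 supB0 supB1); split=> [x Ax|y Ay]; rewrite -num_le /=.
  by apply: ub_le_sup; [exists 1|exists x].
by apply: ge_sup => // _ [x Ax <-]; rewrite num_le; exact: Ay.
Qed.

Lemma i01_infimums A : infimums A !=set0.
Proof.
have [s [s_ub s_lub]] := i01_supremums (lbound A).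
by exists s; split=> // x Ax; apply: s_lub => y; exact.
Qed.

Lemma i01_supremumP A : supremums A (supremum 0%:i01 A).
Proof.
rewrite /supremum; case: eqP => [->|_].
  by split=> [x []|y _]; exact: i01_ge0.
exact: xgetPex (i01_supremums A).
Qed.

Lemma i01_infimumP A : infimums A (infimum 1%:i01 A).
Proof.
rewrite /infimum; case: eqP => [->|_].
  by split=> [x []|y _]; exact: i01_le1.
exact: xgetPex (i01_infimums A).
Qed.

End CompleteLattice.

Section Memories.
Variables (R : realType) (n : nat).
Local Notation I := {i01 R}.
Local Notation vec := 'rV[I]_n.
Implicit Types (C D : I -> I -> I) (x y z : vec) (Z : set vec).

Definition vle x y : Prop := forall i, x 0 i <= y 0 i.

(* Componentwise supremum and infimum in [0,1]^n. The default values 0 and 1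
   are the supremum and the infimum of the empty set in [0,1]; by
   i01_supremumP and i01_infimumP, they are never used as junk values. *)
Definition vsup Z : vec := \row_i supremum 0%:i01 [set z 0 i | z in Z].
Definition vinf Z : vec := \row_i infimum 1%:i01 [set z 0 i | z in Z].

Variable k : nat.
Implicit Types (a : 'I_k -> vec) (lambda theta : 'I_k -> I).

Definition maxC_comb C a lambda : vec :=
  vsup (range (fun xi => map_mx (C (lambda xi)) (a xi))).

Definition minD_comb D a theta : vec :=
  vinf (range (fun xi => map_mx (D (theta xi)) (a xi))).

Definition maxC_combs C a : set vec := range (maxC_comb C a).

Definition minD_combs D a : set vec := range (minD_comb D a).

Definition maxC_PAFMM C a x : vec := vsup [set z | maxC_combs C a z /\ vle z x].

Definition minD_PAFMM D a x : vec := vinf [set y | minD_combs D a y /\ vle x y].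

End Memories.

(* Main.v *)
(* With the left identity as coefficient of a^xi and 0 (for D: 1) as all the
   other coefficients, the combination is a^xi itself; hence a^xi is the largest
   max-C (the smallest min-D) combination below (above) a^xi. *)
Require Import Defs.
From mathcomp Require Import all_boot all_order all_algebra.
From mathcomp Require Import all_classical all_reals interval_inference.

Import Order.TTheory.
Local Open Scope ring_scope.

(** Monotonicity in the second argument squeezes [C 0 x] between 0 and [C 0 1 = 0]. *)
Lemma conj0x (R : realType) (C : {i01 R} -> {i01 R} -> {i01 R})
    (hC : fuzzy_conjunction C) (x : {i01 R}) : C 0%:i01 x = 0%:i01.
Proof.
apply: le_anti; rewrite i01_ge0 andbT -[leRHS](conj01 hC).
exact/(conj_monor hC)/i01_le1.
Qed.

(** Here the squeeze is between [D 1 0 = 1] and the top element 1. *)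
Lemma disj1x (R : realType) (D : {i01 R} -> {i01 R} -> {i01 R})
    (hD : fuzzy_disjunction D) (x : {i01 R}) : D 1%:i01 x = 1%:i01.
Proof.
apply: le_anti; rewrite i01_le1 /= -[leLHS](disj10 hD).
exact/(disj_monor hD)/i01_ge0.
Qed.

(** Applied at two levels: to the terms of one max-[C] combination, and to the set of all
    combinations below [a xi]. In both cases the supremum is attained, so it suffices to exhibit a
    greatest element. *)
Lemma vsup_greatest (R : realType) (n : nat) (Z : set 'rV[{i01 R}]_n)
    (x : 'rV[{i01 R}]_n) :
  Z x -> (forall z, Z z -> vle z x) -> vsup Z = x.
Proof.
move=> Zx Zle; apply/rowP => i; rewrite mxE; set A := (X in supremum _ X).
have [A_ub A_lub] := i01_supremumP A.
apply: le_anti; apply/andP; split.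
  by apply: A_lub => _ [z Zz <-]; exact: Zle.
by apply: A_ub; exists x.
Qed.

Lemma vinf_least (R : realType) (n : nat) (Z : set 'rV[{i01 R}]_n)
    (x : 'rV[{i01 R}]_n) :
  Z x -> (forall z, Z z -> vle x z) -> vinf Z = x.
Proof.
move=> Zx Zge; apply/rowP => i; rewrite mxE; set A := (X in infimum _ X).
have [A_lb A_glb] := i01_infimumP A.
apply: le_anti; apply/andP; split.
  by apply: A_lb; exists x.
by apply: A_glb => _ [z Zz <-]; exact: Zge.
Qed.

Lemma maxC_combs_generator (R : realType) (n k : nat)
    (C : {i01 R} -> {i01 R} -> {i01 R}) (a : 'I_k -> 'rV[{i01 R}]_n)
    (e : {i01 R}) (xi : 'I_k) :
  fuzzy_conjunction C -> left_id e C -> maxC_combs C a (a xi).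
Proof.
move=> hC eC; exists (fun j => if j == xi then e else 0%:i01) => //.
apply: vsup_greatest => [|_ [j _ <-] i].
  by exists xi => //; apply/rowP => i; rewrite mxE eqxx eC.
(* The term at [xi] is [a xi] itself; every other term is the zero vector and so lies below it. *)
rewrite mxE; case: eqP => [->|_]; first by rewrite eC.
by rewrite conj0x// i01_ge0.
Qed.

Lemma minD_combs_generator (R : realType) (n k : nat)
    (D : {i01 R} -> {i01 R} -> {i01 R}) (a : 'I_k -> 'rV[{i01 R}]_n)
    (e : {i01 R}) (xi : 'I_k) :
  fuzzy_disjunction D -> left_id e D -> minD_combs D a (a xi).
Proof.
move=> hD eD; exists (fun j => if j == xi then e else 1%:i01) => //.
apply: vinf_least => [|_ [j _ <-] i].
  by exists xi => //; apply/rowP => i; rewrite mxE eqxx eD.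
(* Dually, the terms away from [xi] are constantly 1 and so lie above [a xi]. *)
rewrite mxE; case: eqP => [->|_]; first by rewrite eD.
by rewrite disj1x// i01_le1.
Qed.

Theorem theorem2 (R : realType) (n k : nat)
    (C D : {i01 R} -> {i01 R} -> {i01 R}) (a : 'I_k -> 'rV[{i01 R}]_n)
    (hC : fuzzy_conjunction C) (hD : fuzzy_disjunction D) :
  ((exists e : {i01 R}, left_id e C) ->
     forall xi : 'I_k, maxC_PAFMM C a (a xi) = a xi) /\
  ((exists e : {i01 R}, left_id e D) ->
     forall xi : 'I_k, minD_PAFMM D a (a xi) = a xi).
Proof.
split=> -[e eid] xi.
  (* Lying below [a xi] is part of membership in the set, so what remains is that [a xi] is itself a
     combination. *)
  apply: vsup_greatest => [|z []//].
  by split=> //; exact: maxC_combs_generator eid.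
apply: vinf_least => [|z []//].
by split=> //; exact: minD_combs_generator eid.
Qed.
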